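(* Let $\Phi$ be a root system in a finite-dimensional real Euclidean space $V$ with simple system $\Pi$, and assume $\mathbb{R}\Pi=V$. Let $W$ be its reflection group, $S=\{s_\alpha\mid\alpha\in\Pi\}$, and let $n\ge1$. Then for every $w\in W$, $$\det{}_{V^n}(w)=\det{}_V(w)^n=\sum_{\mathbf{I}=(I_0,I_1,\dots,I_n)\in\mathcal{I}^{(n)}}(-1)^{|I_1|+|I_2|+\dots+|I_n|}\operatorname{Ind}_{W_{I_n}}^W(1)(w).$$
   Context: $V$ is a finite-dimensional real vector space with inner product $\langle-,-\rangle$. For $0\ne\alpha\in V$ put $s_\alpha(v)=v-\frac{2\langle v,\alpha\rangle}{\langle\alpha,\alpha\rangle}\alpha$. A root system $\Phi$ in $V$ is a finite subset of $V\setminus\{0\}$ such that $s_\alpha(\beta)\in\Phi$ for all $\alpha,\beta\in\Phi$, and such that $\alpha,c\alpha\in\Phi$ with $c\in\mathbb{R}$ implies $c\in\{\pm1\}$. $W$ is the finite group generated by $\{s_\alpha\mid\alpha\in\Phi\}$. A simple system $\Pi\subseteq\Phi$ is a linearly independent subset such that $\Phi=\Phi_+\sqcup(-\Phi_+)$ with $\Phi_+=\Phi\cap\mathbb{R}_{\ge0}\Pi$. For $I\subseteq S$, $W_I=\langle I\rangle$. $\mathcal{I}^{(n)}=\{(I_0,\dots,I_n)\mid S=I_0\supseteq I_1\supseteq\dots\supseteq I_n\}$ is the set of weakly decreasing sequences of $n+1$ subsets of $S$ with first term $S$. $\operatorname{Ind}_{W_{I}}^W(1)$ is the character of $W$ induced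 from the trivial character of $W_I$. $\det_V(w)$ and $\det_{V^n}(w)$ are the determinants of $w$ acting on $V$ and (diagonally) on $V^n=V^{\oplus n}$. *)

(* Defs.v *)
From HB Require Import structures.
From mathcomp Require Import all_boot all_order all_algebra all_fingroup.
From mathcomp Require Import all_field all_character.
From mathcomp Require Import finmap.
From mathcomp Require Import boolp reals ring.

Set Implicit Arguments.
Unset Strict Implicit.
Unset Printing Implicit Defensive.

Import Order.TTheory GRing.Theory Num.Theory.
Local Open Scope fset_scope.
Local Open Scope ring_scope.

Section Reflection.
Variables (R : realType) (V : vectType R) (ip : {dot V for idfun}).

(* The value at alpha = 0 is irrelevant: 0 is never a root. *)
Definition refl (alpha : V) (v : V) : V :=
  v - (2 * ip v alpha / ip alpha alpha) *: alpha.

Lemma refl_linear alpha : linear (refl alpha).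
Proof.
move=> c u v; rewrite /refl linearPl /= scalerBr addrACA -opprD scalerA.
by rewrite -scalerDl; congr (_ - _ *: _); ring.
Qed.

HB.instance Definition _ alpha :=
  GRing.isSemilinear.Build R V V _ (refl alpha)
    (GRing.semilinear_linear (refl_linear alpha)).

Definition reflf (alpha : V) : 'End(V) := linfun (refl alpha).

Lemma reflfE alpha v : reflf alpha v = refl alpha v.
Proof. exact: lfunE. Qed.

Definition is_root_system (Phi : {fset V}) : Prop :=
  [/\ 0 \notin Phi,
      forall alpha beta, alpha \in Phi -> beta \in Phi ->
        refl alpha beta \in Phi
    & forall (alpha : V) (c : R), alpha \in Phi -> c *: alpha \in Phi ->
        c = 1 \/ c = -1].

Record rootSystem := RootSystem {
  roots :> {fset V};
  rootsP : is_root_system roots }.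

Definition nonneg_span (P : {fset V}) (v : V) : Prop :=
  exists2 c : V -> R, (forall alpha, alpha \in P -> 0 <= c alpha) &
    v = \sum_(alpha <- P) c alpha *: alpha.

Definition pos_roots (Phi P : {fset V}) : {fset V} :=
  [fset beta in Phi | `[< nonneg_span P beta >]].

Definition is_simple_system (Phi P : {fset V}) : Prop :=
  let Phi_neg := [fset - beta | beta in pos_roots Phi P] in
  [/\ P `<=` Phi, free P,
      Phi = pos_roots Phi P `|` Phi_neg
    & [disjoint pos_roots Phi P & Phi_neg]].

End Reflection.

Section WeylGroup.
Variables (R : realType) (V : vectType R) (ip : {dot V for idfun}).
Implicit Type Phi : rootSystem ip.

(* The subgroup of GL(V) generated by the reflections in the roots; f^-1 is a
   genuine inverse here, every element being an isometry (weyl_axiom). *)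
Inductive in_weyl Phi : 'End(V) -> Prop :=
| in_weyl_refl alpha : alpha \in roots Phi -> in_weyl Phi (reflf ip alpha)
| in_weyl1 : in_weyl Phi \1%VF
| in_weylM f g : in_weyl Phi f -> in_weyl Phi g -> in_weyl Phi (f \o g)%VF
| in_weylV f : in_weyl Phi f -> in_weyl Phi f^-1%VF.

Let symip u v : ip u v = ip v u.
Proof. by rewrite hermC /= expr0 mul1r. Qed.

Let ip_gt0 u : u != 0 -> 0 < ip u u.
Proof. exact: neq0_dnorm_gt0. Qed.

Let ip_eq0 u : ip u u = 0 -> u = 0.
Proof. by move=> h; apply/eqP/negP => /negP /ip_gt0; rewrite h ltxx. Qed.

Lemma refl_isometry alpha u v : alpha != 0 ->
  ip (refl ip alpha u) (refl ip alpha v) = ip u v.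
Proof.
move=> /ip_gt0 /lt0r_neq0 a0; rewrite /refl.
rewrite linearBl /= linearBr /= linearBr /= !linearZl_LR /= !linearZr_LR /=.
rewrite [ip alpha v]symip.
by field.
Qed.

Lemma reflK alpha : alpha != 0 -> involutive (refl ip alpha).
Proof.
move=> /ip_gt0 /lt0r_neq0 a0 v; rewrite {1 2}/refl linearBl /= linearZl_LR /=.
rewrite /refl -addrA -opprD -scalerDl.
have -> : 2 * ip v alpha / ip alpha alpha +
  2 * (ip v alpha - 2 * ip v alpha / ip alpha alpha * ip alpha alpha) /
   ip alpha alpha = 0 by field.
by rewrite scale0r subr0.
Qed.

Lemma root_neq0 Phi alpha : alpha \in roots Phi -> alpha != 0.
Proof. by case: (rootsP Phi) => h0 _ _; apply: contraTneq => ->. Qed.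

Let iso_lker0 (f : 'End(V)) :
  (forall u v, ip (f u) (f v) = ip u v) -> lker f == 0%VS.
Proof.
move=> fP; apply/lker0P => u v e; apply/subr0_eq/ip_eq0.
by rewrite -fP linearB /= e subrr linear0r.
Qed.

Lemma weyl_axiom Phi f : in_weyl Phi f ->
  [/\ forall u v, ip (f u) (f v) = ip u v,
      forall beta, (f beta \in roots Phi) = (beta \in roots Phi)
    & forall v, f v - v \in <<roots Phi>>%VS].
Proof.
elim=> {f} [alpha Pa | | f g _ [If Rf Sf] _ [Ig Rg Sg] | f _ [If Rf Sf]].
- have a0 := root_neq0 Pa; have [_ Pr _] := rootsP Phi.
  split=> [u v|beta|v]; rewrite !reflfE.
  + exact: refl_isometry.
  + by apply/idP/idP => /(Pr _ _ Pa) //; rewrite reflK.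
  + by rewrite /refl addrAC subrr add0r rpredN rpredZ // memv_span.
- by split=> *; rewrite !lfunE //= subrr rpred0.
- split=> [u v|beta|v]; rewrite !comp_lfunE ?If ?Rf //.
  by rewrite -(subrK (g v) (f (g v))) -addrA rpredD.
- have fVK := lker0_lfunVK (iso_lker0 If).
  split=> [u v|beta|v].
  + by rewrite -If !fVK.
  + by rewrite -Rf fVK.
  + by rewrite -opprB rpredN -{1}[v]fVK.
Qed.

Lemma weyl_lker0 Phi f : in_weyl Phi f -> lker f == 0%VS.
Proof.
by case/weyl_axiom=> fP _ _; apply: iso_lker0.
Qed.

Lemma weyl_inj Phi f g : in_weyl Phi f -> in_weyl Phi g ->
  {in roots Phi, f =1 g} -> f = g.
Proof.
move=> Wf Wg fg; apply/lfunP => v.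
have [If Rf Sf] := weyl_axiom Wf; have [Ig _ Sg] := weyl_axiom Wg.
apply/subr0_eq; set d := f v - g v.
have Sd : d \in <<roots Phi>>%VS.
  have -> : d = (f v - v) - (g v - v) by rewrite /d opprB addrA subrK.
  by rewrite rpredB.
have od beta : beta \in roots Phi -> ip d beta = 0.
  have fVK := lker0_lfunVK (weyl_lker0 Wf).
  rewrite -[beta]fVK Rf => Pb; rewrite /d linearBl /= If fg // Ig.
  by rewrite subrr.
apply: ip_eq0; rewrite {2}(coord_span (X := in_tuple (roots Phi)) Sd) linear_sumr big1 //= => i _.
by rewrite linearZr_LR /= od ?mulr0 // mem_nth.
Qed.

Record weyl Phi := Weyl {
  weyl_val :> 'End(V);
  _ : `[< in_weyl Phi weyl_val >] }.

HB.instance Definition _ Phi := [isSub for @weyl_val Phi].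
HB.instance Definition _ Phi := [Choice of weyl Phi by <:].

Lemma weylP Phi (w : weyl Phi) : in_weyl Phi w.
Proof. exact/asboolP/(valP w). Qed.

(* The group is finite because it acts faithfully on the roots, even when they
   do not span V (weyl_inj). *)
Definition weyl_code Phi (w : weyl Phi) :
    {ffun roots Phi -> option (roots Phi)} :=
  [ffun beta => insub (w (val beta))].

Lemma weyl_code_inj Phi : injective (@weyl_code Phi).
Proof.
move=> f g /ffunP e; apply/val_inj/(weyl_inj (weylP f) (weylP g)) => b Pb /=.
have := e [` Pb]; rewrite !ffunE /=.
have [_ Rf _] := weyl_axiom (weylP f); have [_ Rg _] := weyl_axiom (weylP g).
by rewrite !insubT ?Rf ?Rg // => Pf Pg [].
Qed.

Definition weyl_decode Phi c : option (weyl Phi) :=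
  if pselect (exists w, weyl_code w == c) is left ex then Some (xchoose ex)
  else None.

Lemma weyl_codeK Phi : pcancel (@weyl_code Phi) (@weyl_decode Phi).
Proof.
move=> w; rewrite /weyl_decode; case: pselect => [ex|[]]; last by exists w.
by congr Some; apply/weyl_code_inj/eqP/(xchooseP ex).
Qed.

HB.instance Definition _ Phi := PCanIsCountable (@weyl_codeK Phi).
HB.instance Definition _ Phi : isFinite (weyl Phi) :=
  PCanIsFinite (@weyl_codeK Phi).

Definition mul_weyl Phi (f g : weyl Phi) : weyl Phi :=
  Weyl (asboolT (in_weylM (weylP f) (weylP g))).
Definition one_weyl Phi : weyl Phi := Weyl (asboolT (in_weyl1 Phi)).
Definition inv_weyl Phi (f : weyl Phi) : weyl Phi :=
  Weyl (asboolT (in_weylV (weylP f))).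

Lemma mul_weylA Phi : associative (@mul_weyl Phi).
Proof. by move=> f g h; apply/val_inj/comp_lfunA. Qed.
Lemma mul1_weyl Phi : left_id (one_weyl Phi) (@mul_weyl Phi).
Proof. by move=> f; apply/val_inj/comp_lfun1l. Qed.
Lemma mulV_weyl Phi : left_inverse (one_weyl Phi) (@inv_weyl Phi) (@mul_weyl Phi).
Proof. by move=> f; apply/val_inj/lker0_compVf/(weyl_lker0 (weylP f)). Qed.

HB.instance Definition _ Phi := Finite_isGroup.Build (weyl Phi)
  (@mul_weylA Phi) (@mul1_weyl Phi) (@mulV_weyl Phi).

Definition simple_refls Phi (P : {fset V}) : {set weyl Phi} :=
  [set w : weyl Phi | `[< exists2 alpha, alpha \in P &
                            w = reflf ip alpha :> 'End(V) >]].

End WeylGroup.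

Section Determinants.
Variables (F : fieldType) (U : vectType F).

Definition endo_det (f : 'End(U)) : F :=
  \det (passmx.mxof (vbasis {:U}) (vbasis {:U}) f).

Definition diag_fun n (f : 'End(U)) (u : {ffun 'I_n -> U}) : {ffun 'I_n -> U} :=
  [ffun i => f (u i)].

Lemma diag_fun_linear n f : linear (@diag_fun n f).
Proof. by move=> c u v; apply/ffunP => i; rewrite !ffunE linearP. Qed.

HB.instance Definition _ n f :=
  GRing.isSemilinear.Build F {ffun 'I_n -> U} {ffun 'I_n -> U} _ (@diag_fun n f)
    (GRing.semilinear_linear (@diag_fun_linear n f)).

Definition diag_endo n (f : 'End(U)) : 'End({ffun 'I_n -> U}) :=
  linfun (@diag_fun n f).

Lemma diag_endoE n f u i : diag_endo n f u i = f (u i).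
Proof. by rewrite lfunE /= ffunE. Qed.

End Determinants.

Definition chains (T : finType) (S : {set T}) (n : nat) :
    {set {ffun 'I_n.+1 -> {set T}}} :=
  [set I : {ffun 'I_n.+1 -> {set T}} | (I ord0 == S) &&
     [forall k : 'I_n, I (lift ord0 k) \subset I (widen_ord (leqnSn n) k)]].

(* The library's class functions take values in algC, whereas determinants on V
   lie in R. This map identifies the rational numbers of algC with those of R;
   ind_triv_rat below shows that it loses nothing on the characters used. *)
Definition rat_to (R : realType) (z : algC) : R := ratr (getCrat z).

Definition ind_triv (R : realType) (gT : finGroupType) (G H : {group gT})
    (w : gT) : R :=
  rat_to R ('Ind[G, H] 1 w).

Lemma ind_triv_rat (gT : finGroupType) (G H : {group gT}) (w : gT) :
  H \subset G -> ratr (getCrat ('Ind[G, H] 1 w)) = 'Ind[G, H] 1 w.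
Proof.
move=> sHG; apply: getCratK; rewrite cfIndE // rpredM ?rpredV ?rpred_nat //.
by apply: rpred_sum => x _; rewrite cfun1E rpred_nat.
Qed.

Lemma ind_trivE (R : realType) (gT : finGroupType) (G H : {group gT}) (w : gT) :
  H \subset G ->
  ind_triv R G H w = #|H|%:R^-1 * \sum_(x in G) (w ^ x \in H)%g%:R.
Proof.
move=> sHG; rewrite /ind_triv /rat_to.
suff -> : getCrat ('Ind[G, H] 1 w) =
    #|H|%:R^-1 * \sum_(x in G) (w ^ x \in H)%g%:R.
  rewrite rmorphM fmorphV rmorph_nat rmorph_sum; congr (_ * _).
  by apply: eq_bigr => x _; rewrite rmorph_nat.
apply: (fmorph_inj (@ratr algC)); rewrite [LHS]ind_triv_rat // cfIndE //.
rewrite rmorphM fmorphV rmorph_nat rmorph_sum; congr (_ * _).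
by apply: eq_bigr => x _; rewrite cfun1E rmorph_nat.
Qed.

(* Main.v *)
Require Import Defs.
From HB Require Import structures.
From mathcomp Require Import all_boot all_order all_algebra all_fingroup.
From mathcomp Require Import all_field all_character.
From mathcomp Require Import finmap.
From mathcomp Require Import boolp reals.
From mathcomp Require Import ring lra zify.

Set Implicit Arguments.
Unset Strict Implicit.
Unset Printing Implicit Defensive.

Import passmx.
Import Order.TTheory GRing.Theory Num.Theory.
Local Open Scope ring_scope.

Local Notation roots := Defs.roots.

(** The sum over chains collapses to Solomon's formula for the determinant, which is an
Euler characteristic computation in the fixed space of w.

Chains.  With I_2, ..., I_n fixed, the sum of (-1)^|I_1| over I_2 <= I_1 <= S
vanishes unless I_2 = S, where it is (-1)^|S|.  Hence removing the first two
steps of the chains does not change the alternating sum ([chain_sum_period]),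
whatever function of the last term is summed.  So only n = 0 and n = 1 matter.
For n = 0 the sum is the trivial character induced from W_S, and W_S = W
([simple_refls_gen]); for n = 1 it is Solomon's expression for the determinant
([solomon_formula]).  This matches the powers of det w, because (det w)^2 = 1.

Solomon's formula.  Let C_I be the face of the closed dominant chamber on which
exactly the simple roots with reflection in I vanish.  The stabilizer of each
point of C_I is W_I, and points of the chamber in the same orbit are equal
([dominant_stab], [dominant_unique]).  Hence V is the disjoint union of the
faces x C_I, indexed by the cosets x W_I, and w fixes the coset x W_I if and only
if it fixes x C_I pointwise.  So the value at w of the character induced from
W_I counts the faces x C_I contained in the fixed space V^w, and the alternating
sum over I is (-1)^(dim V) times the sum of (-1)^(dim F) over the faces F in V^w.
These are the sign classes cut out in V^w by the hyperplanes orthogonal to the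
roots, and Euler's relation ([euler_relation]) evaluates the last sum as
(-1)^(dim V^w).  Finally det w = (-1)^(dim V - dim V^w) since w is an isometry
([endo_det_isometry]).

The determinant on V^n is multiplicative, so it is enough to compute it on
reflections, which are rank one perturbations of the identity in each of the n
coordinates ([endo_det_diag_rank1]). *)

(** * Determinants of endomorphisms *)

(** Both sides are the determinant of the block matrix ((1, -r), (c, 1)), cleared by
    the unipotent matrix ((1, r), (0, 1)) acting on the right or on the left. *)
Lemma det_rank1 (F : comPzRingType) n (c : 'cV[F]_n) (r : 'rV[F]_n) :
  \det (1%:M + c *m r) = 1 + (r *m c) 0 0.
Proof.
pose M : 'M[F]_(1 + n) := block_mx 1%:M (- r) c 1%:M.
pose N : 'M[F]_(1 + n) := block_mx 1%:M r 0 1%:M.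
have dN : \det N = 1 by rewrite det_ublock !det1 mulr1.
have MN : \det (M *m N) = \det (1%:M + c *m r).
  rewrite mulmx_block !mulmx1 !mul1mx !mulmx0 !addr0 subrr.
  by rewrite det_lblock det1 mul1r addrC.
have NM : \det (N *m M) = 1 + (r *m c) 0 0.
  rewrite mulmx_block !mulmx1 !mul1mx !mul0mx !add0r addNr.
  by rewrite det_lblock det1 mulr1 det_mx11 !mxE eqxx.
by rewrite -MN det_mulmx mulrC -det_mulmx NM.
Qed.

Section EndoDet.
Variables (F : fieldType) (U : vectType F).
Implicit Types f g : 'End(U).

Let e := vbasis {:U}.
Let eP : basis_of {:U} e := vbasisP {:U}.

Lemma endo_det1 : endo_det (\1%VF : 'End(U)) = 1.
Proof.
rewrite /endo_det (_ : mxof _ _ _ = 1%:M) ?det1 //.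
by apply/row_matrixP => i; rewrite !rowE mul_mxof lfunE /= vecofK // mulmx1.
Qed.

Lemma endo_detM f g : endo_det (f \o g)%VF = endo_det f * endo_det g.
Proof.
rewrite /endo_det mulrC -det_mulmx; congr (\det _).
apply/row_matrixP => i; rewrite !rowE mulmxA !mul_mxof comp_lfunE.
by rewrite rVofK.
Qed.

Lemma endo_det_rank1 f (phi : {linear U -> F^o}) u :
  (forall v, f v = v + phi v *: u) -> endo_det f = 1 + phi u.
Proof.
move=> fE; pose c : 'cV[F]_(\dim {:U}) := \col_i phi e`_i.
have -> : phi u = (rVof e u *m c) 0 0.
  rewrite {1}(coord_basis eP (memvf u)) linear_sum mxE /=.
  by apply: eq_bigr => i _; rewrite !mxE linearZ.
rewrite -det_rank1; congr (\det _); apply/row_matrixP => i.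
rewrite !rowE mulmxDr mulmx1 mulmxA mul_mxof fE linearD linearZ /=.
rewrite vecofK // vecof_delta; congr (_ + _).
by rewrite -rowE [row i c]mx11_scalar mul_scalar_mx !mxE.
Qed.
End EndoDet.

Section DiagonalDet.
Variables (F : fieldType) (U : vectType F) (n : nat).
Implicit Types f g : 'End(U).

Lemma diag_endo1 : diag_endo n (\1%VF : 'End(U)) = \1%VF.
Proof. by apply/lfunP => u; apply/ffunP => i; rewrite diag_endoE !id_lfunE. Qed.

Lemma diag_endoM f g : diag_endo n (f \o g)%VF = (diag_endo n f \o diag_endo n g)%VF.
Proof.
by apply/lfunP => u; apply/ffunP => i; rewrite comp_lfunE !diag_endoE comp_lfunE.
Qed.

(** [f] acting on the first [k] coordinates only.  These maps interpolate between
    the identity ([k = 0]) and the diagonal map ([k = n]), and consecutive ones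
    differ by a rank one perturbation of the identity. *)
Definition upto_fun f k (u : {ffun 'I_n -> U}) : {ffun 'I_n -> U} :=
  [ffun i : 'I_n => if (i < k)%N then f (u i) else u i].

Lemma upto_fun_linear f k : linear (upto_fun f k).
Proof. by move=> c u v; apply/ffunP => i; rewrite !ffunE; case: ifP; rewrite ?linearP. Qed.

HB.instance Definition _ f k :=
  GRing.isSemilinear.Build F {ffun 'I_n -> U} {ffun 'I_n -> U} _ (upto_fun f k)
    (GRing.semilinear_linear (upto_fun_linear f k)).

Lemma endo_det_diag_rank1 f (phi : {linear U -> F^o}) a :
  (forall v, f v = v + phi v *: a) ->
  endo_det (diag_endo n f) = endo_det f ^+ n.
Proof.
move=> fE; have upto k : (k <= n)%N -> endo_det (linfun (upto_fun f k)) = endo_det f ^+ k.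
  elim: k => [_|k IHk lt_kn].
    rewrite expr0 -(endo_det1 {ffun 'I_n -> U}); congr endo_det.
    by apply/lfunP => u; apply/ffunP => i; rewrite lfunE /= ffunE id_lfunE.
  pose k' := Ordinal lt_kn.
  pose d : {ffun 'I_n -> U} := [ffun i => if i == k' then a else 0].
  pose psi (u : {ffun 'I_n -> U}) : F^o := phi (u k').
  have psiL : linear psi by move=> c u v; rewrite /psi !ffunE linearP.
  pose psi' : {linear {ffun 'I_n -> U} -> F^o} :=
    HB.pack psi (GRing.isSemilinear.Build F _ F^o _ psi (GRing.semilinear_linear psiL)).
  pose bf (u : {ffun 'I_n -> U}) := u + psi u *: d.
  have bL : linear bf.
    move=> c u v; rewrite /bf psiL scalerDl scalerDr -scalerA.
    by rewrite addrACA.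
  pose b' : {linear {ffun 'I_n -> U} -> {ffun 'I_n -> U}} :=
    HB.pack bf (GRing.isSemilinear.Build F _ _ _ bf (GRing.semilinear_linear bL)).
  have -> : linfun (upto_fun f k.+1) = (linfun (upto_fun f k) \o linfun b')%VF.
    apply/lfunP => u; apply/ffunP => i; rewrite comp_lfunE !lfunE /= /bf !ffunE.
    have [->|nik] := eqVneq i k'; first by rewrite /= ltnn ltnS leqnn fE.
    rewrite scaler0 addr0 ltnS leq_eqVlt; congr (if _ then _ else _).
    by rewrite (_ : (i == k :> nat) = false) //; apply/negbTE.
  rewrite endo_detM IHk 1?ltnW // exprSr; congr (_ * _).
  rewrite (@endo_det_rank1 _ _ _ psi' d) => [|v]; last by rewrite lfunE.
  by rewrite (endo_det_rank1 fE) /= /psi ffunE eqxx.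
rewrite -(upto n) //; congr endo_det; apply/lfunP => u; apply/ffunP => i.
by rewrite diag_endoE lfunE /= ffunE ltn_ord.
Qed.
End DiagonalDet.

(** * Isometries and orthogonality *)

Section Euclid.
Variables (R : realType) (V : vectType R) (ip : {dot V for idfun}).
Implicit Types (u v a : V) (f : 'End(V)) (U : {vspace V}).

Lemma ipC u v : ip u v = ip v u.
Proof. by rewrite hermC /= expr0 mul1r. Qed.

Lemma ip_gt0 u : u != 0 -> 0 < ip u u.
Proof. exact: neq0_dnorm_gt0. Qed.

Lemma ip_eq0 u : ip u u = 0 -> u = 0.
Proof. by move=> h; apply/eqP/negP => /negP /ip_gt0; rewrite h ltxx. Qed.

Lemma ipNr u v : ip u (- v) = - ip u v.
Proof. exact: linearNr. Qed.

Lemma refl_rank1 a : exists phi : {linear V -> R^o},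
  (forall v, reflf ip a v = v + phi v *: a) /\ (a != 0 -> phi a = -2).
Proof.
pose phi : V -> R^o := fun v => - (2 * ip v a / ip a a).
have phiL : linear phi.
  move=> c u v; rewrite /phi linearPl /= /GRing.scale /=.
  by rewrite mulrDr mulrDl opprD mulrCA -!mulrA mulrN.
pose phi' : {linear V -> R^o} :=
  HB.pack phi (GRing.isSemilinear.Build R V R^o _ phi (GRing.semilinear_linear phiL)).
exists phi'; split=> [v|a0]; first by rewrite reflfE /refl scaleNr.
by rewrite /= /phi mulfK // lt0r_neq0 ?ip_gt0.
Qed.

Lemma endo_det_refl a : a != 0 -> endo_det (reflf ip a) = -1.
Proof.
move=> a0; have [phi [phiE phia]] := refl_rank1 a.
by rewrite (endo_det_rank1 phiE) phia //; ring.
Qed.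

(** For two vectors of equal length, the difference [a] is orthogonal to the sum. *)
Lemma refl_norm a u : ip u u = ip (u + a) (u + a) -> refl ip a (u + a) = u.
Proof.
have [->|a0] := eqVneq a 0; first by rewrite /refl scaler0 subr0 addr0.
have na := lt0r_neq0 (ip_gt0 a0).
rewrite !linearDl /= !linearDr /= [ip a u]ipC => h.
rewrite /refl linearDl /= (_ : 2 * _ / _ = 1) ?scale1r ?addrK //.
by apply: (mulIf na); rewrite mulfVK //; lra.
Qed.

Definition fixv f : {vspace V} := lker (f - \1%VF).

Lemma mem_fixv f v : (v \in fixv f) = (f v == v).
Proof. by rewrite memv_ker !lfun_simp subr_eq0. Qed.

Lemma dim_add_line U v : v \notin U -> \dim (U + <[v]>) = (\dim U).+1.
Proof.
move=> vU; rewrite dimv_disjoint_sum; last first.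
  apply/eqP; rewrite -subv0; apply/subvP => x; rewrite memv_cap => /andP[xU].
  case/vlineP => k xk; move: xU; rewrite xk.
  have [->|k0] := eqVneq k 0; first by rewrite scale0r !mem0v.
  move=> kvU; case/negP: vU; by rewrite -[v](scalerK k0) rpredZ.
by rewrite dim_vline; case: eqP vU => [->|_ _]; rewrite ?mem0v // addn1.
Qed.

(** If [f v <> v], composing [f] with the reflection that maps [f v] back to [v]
    enlarges the fixed space by exactly the line of [v] and changes the sign of the
    determinant; this is iterated until the fixed space is everything. *)
Lemma endo_det_isometry f : (forall u v, ip (f u) (f v) = ip u v) ->
  endo_det f = (-1) ^+ (\dim {:V} + \dim (fixv f)).
Proof.
have [m] := ubnP (\dim {:V} - \dim (fixv f))%N.
elim: m f => // m IHm f; rewrite ltnS => le_m If.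
have le_fV g : (\dim (fixv g) <= \dim {:V})%N by rewrite dimvS ?subvf.
have [fT|/eqP fT] := eqVneq (fixv f) {:V}%VS.
  rewrite fT addnn -mul2n exprM sqrrN expr1n expr1n -(endo_det1 V).
  congr endo_det; apply/lfunP => v; rewrite id_lfunE; apply/eqP.
  by rewrite -mem_fixv fT memvf.
have /existsNP[v /negP] : ~ forall v, v \in fixv f.
  by move=> h; apply/fT/vspaceP => v; rewrite h memvf.
rewrite mem_fixv => fv; pose a := f v - v.
have a0 : a != 0 by rewrite subr_eq0.
have sa : refl ip a (f v) = v.
  by have := @refl_norm a v; rewrite /a addrC subrK If; exact.
pose g := (reflf ip a \o f)%VF.
have Ig u1 u2 : ip (g u1) (g u2) = ip u1 u2.
  by rewrite !comp_lfunE !reflfE /= refl_isometry.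
have gfix : fixv g = (fixv f + <[v]>)%VS.
  apply/vspaceP => u; apply/idP/idP.
    rewrite mem_fixv comp_lfunE reflfE => /eqP gu.
    have fu : f u = refl ip a u by rewrite -[in RHS]gu reflK.
    rewrite -[u](addrK ((2 * ip u a / ip a a) *: v)) memv_add //.
      rewrite mem_fixv linearD linearZ /= fu /refl /a scalerBr.
      by rewrite opprB addrA subrK.
    by rewrite memvN memvZ ?memv_line ?orbT.
  case/memv_addP => x; rewrite mem_fixv => /eqP fx [_ /vlineP[k ->] ->].
  rewrite mem_fixv comp_lfunE linearD linearZ /= fx reflfE linearD linearZ /= sa.
  rewrite /refl (_ : ip x a = 0) ?mulr0 ?mul0r ?scale0r ?subr0 //.
  by rewrite /a linearBr /= -{1}fx If subrr.
have dg : \dim (fixv g) = (\dim (fixv f)).+1.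
  by rewrite gfix dim_add_line // mem_fixv.
have : endo_det g = - endo_det f by rewrite endo_detM endo_det_refl // mulN1r.
rewrite IHm // ?dg.
  by rewrite addnS exprS mulN1r => /oppr_inj.
by have := le_fV g; rewrite dg; lia.
Qed.

Lemma mem_perp v a : (v \in orthov ip <[a]>%VS) = (ip v a == 0).
Proof. exact: mem_orthov1. Qed.

Lemma notin_perp U a : a \notin orthov ip U -> exists2 u, u \in U & ip u a != 0.
Proof. by case/mem_orthovPn => u uU au; exists u; rewrite // ipC. Qed.

(** The map sending a vector to its inner products with the members of [s] has kernel
    the orthogonal space of [s].  It is already injective on the span of [s], so by
    dimension it is onto. *)
Lemma gram_image (s : seq V) : free s ->
  (forall g : 'I_(size s) -> R, exists v, forall i : 'I_(size s), ip v s`_i = g i) /\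
  (\dim (orthov ip <<s>>) + size s = \dim {:V})%N.
Proof.
move=> fs; pose F v : 'rV[R]_(size s) := \row_(i < size s) ip v s`_i.
have FL : linear F.
  by move=> c u v; apply/rowP => i; rewrite !mxE linearPl.
pose F' : {linear V -> 'rV[R]_(size s)} :=
  HB.pack F (GRing.isSemilinear.Build R V _ _ F (GRing.semilinear_linear FL)).
pose f := linfun F'.
have fE v (i : 'I_(size s)) : f v 0 i = ip v s`_i by rewrite lfunE /= mxE.
have kerf : lker f = orthov ip <<s>>.
  apply/vspaceP => v; rewrite memv_ker; apply/eqP/mem_orthovP => [fv0 u|vs].
    move=> us; rewrite (coord_span (X := in_tuple s) us) linear_sumr big1 //= => i _.
    by rewrite linearZr_LR /= -[ip v _](fE v i) fv0 mxE mulr0.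
  apply/rowP => i; rewrite fE mxE; apply: vs.
  by rewrite memv_span // mem_nth.
have fimg : (f @: {:V} = {:'rV[R]_(size s)})%VS.
  apply/eqP; rewrite eqEdim subvf /=.
  rewrite dimvf /= /dim /= mul1n.
  have fs_dim : \dim (f @: <<s>>) = size s.
    rewrite limg_dim_eq ?kerf; first by apply/eqP.
    apply/eqP; rewrite -subv0; apply/subvP => v.
    by rewrite memv_cap => /andP[vs /mem_orthovP/(_ v vs)/ip_eq0->]; rewrite mem0v.
  by rewrite -[leqLHS]fs_dim dimvS // limgS // subvf.
split=> [g|]; last first.
  rewrite -kerf -(limg_ker_dim f {:V}) capfv fimg; congr (_ + _)%N.
  by rewrite dimvf /= /dim /= mul1n.
have : \row_i g i \in (f @: {:V})%VS by rewrite fimg memvf.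
by case/memv_imgP => v _ fv; exists v => i; rewrite -fE -fv mxE.
Qed.

Lemma refl_fixE a v : a != 0 -> (refl ip a v == v) = (ip v a == 0).
Proof.
move=> a0; rewrite /refl -subr_eq0 addrAC subrr add0r oppr_eq0 scaler_eq0.
by rewrite (negPf a0) orbF !mulf_eq0 invr_eq0 (gt_eqF (ip_gt0 a0)) orbF pnatr_eq0.
Qed.

(** * Euler's relation for hyperplane arrangements *)

(** Open convex cones, presented by finitely many strict inequalities. *)
Definition pos_on (C : seq V) v := all (fun c => 0 < ip v c) C.

Lemma pos_on_lin C x y (s t : R) : 0 < s -> 0 < t ->
  pos_on C x -> pos_on C y -> pos_on C (s *: x + t *: y).
Proof.
move=> s0 t0 /allP Cx /allP Cy; apply/allP => c cC.
by rewrite linearDl /= !linearZl_LR /= addr_gt0 // mulr_gt0 ?Cx ?Cy.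
Qed.

Lemma pos_on_open C v u : pos_on C v ->
  exists2 e : R, 0 < e & forall t : R, `|t| <= e -> pos_on C (v + t *: u).
Proof.
elim: C => [|c C IHC] /=; first by exists 1.
case/andP=> vc /IHC[e e0 eC]; set k := ip u c.
have k1 : 0 < 1 + `|k| by rewrite ltr_pwDl.
(* The summand 1 keeps the denominator positive when [k = 0]. *)
exists (Num.min e (ip v c / (1 + `|k|))); first by rewrite lt_min e0 divr_gt0.
move=> t; rewrite le_min => /andP[te tk]; rewrite eC // andbT.
rewrite linearDl /= linearZl_LR /= -/k -ltrBlDl sub0r ltrNl.
rewrite (le_lt_trans (ler_norm _)) // normrN normrM.
apply: (@le_lt_trans _ _ (ip v c / (1 + `|k|) * `|k|)); first by rewrite ler_wpM2r.
by rewrite mulrAC ltr_pdivrMr // ltr_pM2l // ltrDr.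
Qed.

Section EulerRelation.
Variables (X : finType) (pt : X -> V) (wt : X -> R).

Definition same_signs (L : seq V) u v :=
  all (fun a => Num.sg (ip u a) == Num.sg (ip v a)) L.

Definition zero_space (L : seq V) v : {vspace V} :=
  (\bigcap_(a <- L | (ip v a == 0)%R) orthov ip <[a]>)%VS.

Lemma mem_zero_space L u v :
  (u \in zero_space L v) = all (fun a => (ip v a == 0) ==> (ip u a == 0)) L.
Proof.
rewrite /zero_space; elim: L => [|a L IHL] /=; first by rewrite big_nil memvf.
by rewrite big_cons; case: ifP => _; rewrite ?memv_cap ?mem_perp IHL.
Qed.

(** [zero_space L v], cut with [U], is the span of the sign class of [v] in [U] for the
    linear forms [ip _ a], [a] in [L].  If the weights of the points [pt i] in each sign
    class of [U] add up to (-1)^(dimension of the class), then the weights in [U] add up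
    to (-1)^(dim U), and the same holds after cutting with an open convex cone [C].

    The forms are processed one at a time.  The hyperplane of [a] splits the part of
    [U] in [C] into its zero, positive and negative parts.  Either exactly one of the
    three is nonempty and it has the dimension of [U], or all three are nonempty and
    their contributions are (-1)^(d-1) + (-1)^d + (-1)^d = (-1)^d. *)
Lemma euler_relation L U C :
  (forall v, v \in U -> pos_on C v ->
     \sum_(i | [&& pt i \in U, pos_on C (pt i) & same_signs L (pt i) v]) wt i
       = (-1) ^+ \dim (U :&: zero_space L v)) ->
  forall v, v \in U -> pos_on C v ->
    \sum_(i | (pt i \in U) && pos_on C (pt i)) wt i = (-1) ^+ \dim U.
Proof.
elim: L U C => [|a L IHL] U C faceP v vU vC.
  have := faceP v vU vC; rewrite /zero_space big_nil capvf => <-.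
  by apply: eq_bigl => i; rewrite /= andbT.
pose T D (W : {vspace V}) := \sum_(i | (pt i \in W) && pos_on D (pt i)) wt i.
have T0 D (W : {vspace V}) : (forall x, x \in W -> pos_on D x -> False) -> T D W = 0.
  by move=> h; apply: big_pred0 => i; apply/negP => /andP[]; exact: h.
have splitT : T C U = T C (U :&: orthov ip <[a]>)%VS + (T (a :: C) U + T (- a :: C) U).
  rewrite /T (bigID (fun i => ip (pt i) a == 0)) /=; congr (_ + _).
    by apply: eq_bigl => i; rewrite memv_cap mem_perp andbAC.
  rewrite (bigID (fun i => 0 < ip (pt i) a)) /=; congr (_ + _).
    apply: eq_bigl => i; rewrite -!andbA; congr (_ && _).
    by case: ltgtP; rewrite ?andbF ?andbT.
  apply: eq_bigl => i; rewrite -!andbA; congr (_ && _).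
  by rewrite linearNr oppr_gt0; case: ltgtP; rewrite ?andbF ?andbT.
have Tzero x : x \in U -> pos_on C x -> ip x a = 0 ->
    T C (U :&: orthov ip <[a]>)%VS = (-1) ^+ \dim (U :&: orthov ip <[a]>).
  move=> xU xC xa; apply: (IHL _ _ _ x) => //; last by rewrite memv_cap xU mem_perp xa eqxx.
  move=> y; rewrite memv_cap mem_perp => /andP[yU /eqP ya] yC.
  have := faceP y yU yC; rewrite /zero_space big_cons ya eqxx capvA => <-.
  apply: eq_bigl => i /=; rewrite memv_cap mem_perp ya sgr0 sgr_eq0.
  by rewrite -!andbA; congr (_ && _); rewrite andbCA.
have Tpos x : x \in U -> pos_on C x -> 0 < ip x a -> T (a :: C) U = (-1) ^+ \dim U.
  move=> xU xC xa; apply: (IHL _ _ _ x) => //=; last by rewrite xa.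
  move=> y yU /andP[ya yC]; have := faceP y yU yC.
  rewrite /zero_space big_cons gt_eqF // => <-.
  by apply: eq_bigl => i /=; rewrite (gtr0_sg ya) sgr_cp0 -!andbA; congr (_ && _); rewrite andbCA.
have Tneg x : x \in U -> pos_on C x -> ip x a < 0 -> T (- a :: C) U = (-1) ^+ \dim U.
  move=> xU xC xa; apply: (IHL _ _ _ x) => //=; last by rewrite linearNr oppr_gt0 xa.
  move=> y yU /andP[]; rewrite linearNr oppr_gt0 => ya yC; have := faceP y yU yC.
  rewrite /zero_space big_cons lt_eqF // => <-.
  apply: eq_bigl => i /=; rewrite linearNr oppr_gt0 (ltr0_sg ya) sgr_cp0 -!andbA.
  by congr (_ && _); rewrite andbCA.
rewrite [LHS]splitT.
case: (pselect (exists x, [/\ x \in U, pos_on C x & ip x a = 0])) => [[x [xU xC xa]]|no0].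
  rewrite (Tzero x) //; have [aU|aU] := boolP (a \in orthov ip U).
    rewrite (_ : U :&: _ = U)%VS; last by apply/capv_idPl; rewrite orthov_sym.
    have Ua y : y \in U -> ip y a = 0.
      by move/mem_orthovP: aU => aU yU; rewrite ipC aU.
    by rewrite !T0 ?addr0 // => y yU /andP[]; rewrite ?linearNr /= Ua // ?oppr0 ltxx.
  have dU := eq_dim_orthov1 aU; have [u uU ua] := notin_perp aU; have [e e0 eP] := pos_on_open u xC.
  have yU t : x + t *: u \in U by rewrite memvD ?memvZ.
  have yC t : `|t| = e -> pos_on C (x + t *: u) by move=> te; rewrite eP ?te.
  have ya t : ip (x + t *: u) a = t * ip u a.
    by rewrite linearDl /= linearZl_LR /= xa add0r.
  have eu : `|e| = e by rewrite gtr0_norm.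
  have enu : `|- e| = e by rewrite normrN.
  have dU0 : (0 < \dim U)%N.
    rewrite lt0n dimv_eq0; apply: contraNneq ua => U0.
    by move: uU; rewrite U0 memv0 => /eqP ->; rewrite linear0l.
  rewrite -dU.
  have [up|un] : 0 < ip u a \/ ip u a < 0.
    by apply/orP; rewrite orbC -neq_lt.
  - have -> : T (a :: C) U = (-1) ^+ \dim U.
      by apply: (Tpos (x + e *: u)); rewrite ?yU ?yC // ya mulr_gt0.
    have -> : T (- a :: C) U = (-1) ^+ \dim U.
      by apply: (Tneg (x + (- e) *: u)); rewrite ?yU ?yC // ya mulNr oppr_lt0 mulr_gt0.
    by rewrite -(prednK dU0) exprS /= mulN1r addrA subrr add0r.
  - have -> : T (a :: C) U = (-1) ^+ \dim U.
      by apply: (Tpos (x + (- e) *: u)); rewrite ?yU ?yC // ya nmulr_rgt0 // oppr_lt0.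
    have -> : T (- a :: C) U = (-1) ^+ \dim U.
      by apply: (Tneg (x + e *: u)); rewrite ?yU ?yC // ya pmulr_rlt0.
    by rewrite -(prednK dU0) exprS /= mulN1r addrA subrr add0r.
have no_both x y : x \in U -> pos_on C x -> y \in U -> pos_on C y ->
    0 < ip x a -> ip y a < 0 -> False.
  move=> xU xC yU yC xa ya; apply: no0.
  (* This positive combination of [x] and [y] lies on the hyperplane of [a]. *)
  exists ((- ip y a) *: x + ip x a *: y); split.
  - by rewrite memvD ?memvZ.
  - by rewrite pos_on_lin ?oppr_gt0.
  - by rewrite linearDl /= !linearZl_LR /=; ring.
have n0 x : x \in U -> pos_on C x -> ip x a != 0.
  by move=> xU xC; apply/eqP => xa; apply: no0; exists x.
rewrite T0 ?add0r => [|x]; last first.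
  rewrite memv_cap mem_perp => /andP[xU xa] xC.
  by have := n0 _ xU xC; rewrite xa.
case: (ltgtP (ip v a) 0) => va; last by have := n0 v vU vC; rewrite va eqxx.
- rewrite T0 ?add0r => [|x xU /andP[xa xC]]; last exact: (no_both x v).
  exact: (Tneg v).
- rewrite (Tpos v) // T0 ?addr0 // => x xU /= /andP[]; rewrite linearNr oppr_gt0.
  by move=> xa xC; apply: (no_both v x).
Qed.
End EulerRelation.
End Euclid.

(** * The action of the reflection group *)

Section WeylAction.
Variables (R : realType) (V : vectType R) (ip : {dot V for idfun}).
Variable Phi : rootSystem ip.
Implicit Types (x y w : weyl Phi) (u v a b : V).

Lemma weylM x y v : (x * y)%g v = x (y v).
Proof. exact: comp_lfunE. Qed.

Lemma weyl1 v : (1%g : weyl Phi) v = v.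
Proof. exact: id_lfunE. Qed.

Lemma weylVK x v : (x^-1)%g (x v) = v.
Proof. by rewrite -weylM mulVg weyl1. Qed.

Lemma weylKV x v : x ((x^-1)%g v) = v.
Proof. by rewrite -weylM mulgV weyl1. Qed.

Lemma weyl_ip x u v : ip (x u) (x v) = ip u v.
Proof. by have [-> _ _] := weyl_axiom (weylP x). Qed.

Lemma weyl_root x b : (x b \in roots Phi) = (b \in roots Phi).
Proof. by have [_ -> _] := weyl_axiom (weylP x). Qed.

Lemma weyl_adj x u v : ip (x u) v = ip u ((x^-1)%g v).
Proof. by rewrite -(weyl_ip x u) weylKV. Qed.

Lemma weyl_eqP x y : (forall v, x v = y v) -> x = y.
Proof. by move=> xy; apply/val_inj/lfunP. Qed.

(** Outside the roots this is the identity, a default value. *)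
Definition wrefl a : weyl Phi := insubd (one_weyl Phi) (reflf ip a).

Lemma wreflE a v : a \in roots Phi -> wrefl a v = refl ip a v.
Proof.
move=> aPhi; rewrite -reflfE.
suff -> : wrefl a = reflf ip a :> 'End(V) by [].
by rewrite [LHS]val_insubd asboolT //; apply: in_weyl_refl.
Qed.

Lemma wrefl_conj x a : a \in roots Phi -> wrefl (x a) = (x * wrefl a * x^-1)%g.
Proof.
move=> aPhi; apply: weyl_eqP => v; rewrite !weylM !wreflE ?weyl_root //.
have xB u k : x (u - k *: a) = x u - k *: x a by rewrite linearB linearZ.
rewrite /refl xB weylKV !weyl_ip.
by rewrite -[ip v (x a)](weyl_ip (x^-1)%g) weylVK.
Qed.

Lemma wreflV a : a \in roots Phi -> (wrefl a * wrefl a = 1)%g.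
Proof.
move=> aPhi; apply: weyl_eqP => v.
by rewrite weylM !wreflE // reflK ?weyl1 // (root_neq0 aPhi).
Qed.

Lemma wrefl_self a : a \in roots Phi -> wrefl a a = - a.
Proof.
move=> aPhi; have na := lt0r_neq0 (ip_gt0 ip (root_neq0 aPhi)).
rewrite wreflE // /refl mulfK //.
by rewrite scaler_nat mulr2n opprD addrA subrr add0r.
Qed.

Lemma wreflN a : wrefl (- a) = wrefl a.
Proof.
rewrite /wrefl (_ : reflf ip (- a) = reflf ip a) //; apply/lfunP => v.
by rewrite !reflfE /refl !linearNr !linearNl /= opprK mulrN mulNr scalerN scaleNr opprK.
Qed.

Lemma rootN a : a \in roots Phi -> - a \in roots Phi.
Proof. by move=> aPhi; rewrite -wrefl_self // weyl_root. Qed.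

Definition stab v := [set x : weyl Phi | x v == v].

Lemma stab_group_set v : group_set (stab v).
Proof.
apply/group_setP; split=> [|x y]; rewrite !inE ?weyl1 //.
by move=> /eqP xv /eqP yv; rewrite weylM yv xv.
Qed.
Canonical stab_group v := Group (stab_group_set v).

End WeylAction.

(** Both sides are multiplicative in [w], so only the generating reflections matter. *)
Lemma endo_det_diag_weyl (R : realType) (V : vectType R) (ip : {dot V for idfun})
    (Phi : rootSystem ip) n (w : weyl Phi) :
  endo_det (diag_endo n w) = endo_det w ^+ n.
Proof.
elim: {w}(weyl_val w) / (weylP w) => [a aPhi||f g _ IHf _ IHg|f Wf IHf].
- have [phi [fE _]] := refl_rank1 ip a.
  by apply: endo_det_diag_rank1 => v; rewrite fE.
- by rewrite diag_endo1 !endo_det1 expr1n.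
- by rewrite diag_endoM !endo_detM IHf IHg exprMn.
- have fVf := lker0_compVf (weyl_lker0 Wf).
  have dV : endo_det f^-1%VF * endo_det f = 1 by rewrite -endo_detM fVf endo_det1.
  have dn : endo_det (diag_endo n f^-1%VF) * endo_det f ^+ n = 1.
    by rewrite -IHf -endo_detM -diag_endoM fVf diag_endo1 endo_det1.
  have f0 : endo_det f ^+ n != 0.
    by apply/eqP => f0; move: dn; rewrite f0 mulr0 => /esym/eqP; rewrite oner_eq0.
  by apply: (mulIf f0); rewrite dn -exprMn dV expr1n.
Qed.

(** * Simple systems and generation by simple reflections *)

Lemma sgr_ge0_eq (R : realDomainType) (r s : R) :
  0 <= r -> 0 <= s -> (r = 0 <-> s = 0) -> Num.sg r = Num.sg s.
Proof.
move=> r0 s0 rs; have [r00|rn0] := eqVneq r 0; first by rewrite r00 (rs.1 r00).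
have sn0 : s != 0 by apply: contraNneq rn0 => /rs.2 ->.
by rewrite !gtr0_sg // lt_def ?sn0 ?rn0.
Qed.

Section SimpleSystem.
Variables (R : realType) (V : vectType R) (ip : {dot V for idfun}).
Variables (Phi : rootSystem ip) (P : {fset V}).
Hypothesis hP : is_simple_system Phi P.
Implicit Types (x y w : weyl Phi) (u v a b : V) (t : seq V) (I : {set weyl Phi}).

Local Notation S := (simple_refls Phi P).

Lemma simple_root a : a \in P -> a \in roots Phi.
Proof. by case: hP => /fsubsetP + _ _ _; exact. Qed.

Lemma simple_neq0 a : a \in P -> a != 0.
Proof. by move=> aP; apply: root_neq0 (simple_root aP). Qed.

Lemma root_dichotomy b : b \in roots Phi -> nonneg_span P b \/ nonneg_span P (- b).
Proof.
case: hP => _ _ PhiE _; rewrite PhiE in_fsetU => /orP[].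
  by rewrite !inE => /andP[_ /asboolP]; left.
case/imfsetP => c /=; rewrite !inE => /andP[_ /asboolP cP] ->.
by right; rewrite opprK.
Qed.

(** Simple roots are linearly independent, so inner products with them can be
    prescribed. *)
Lemma dual_vector (g : V -> R) : {v | forall a, a \in P -> ip v a = g a}.
Proof.
apply: cid; case: hP => _ fP _ _; have [+ _] := gram_image ip fP.
move/(_ (fun i => g P`_i)) => [v vP]; exists v => a aP.
have ai : (index a P < size P)%N by rewrite index_mem.
by have := vP (Ordinal ai); rewrite /= nth_index.
Qed.

Definition dualv g := sval (dual_vector g).

Lemma dualvE g a : a \in P -> ip (dualv g) a = g a.
Proof. exact: (svalP (dual_vector g)). Qed.

Lemma ip_span v (c : V -> R) :
  ip v (\sum_(a <- P) c a *: a) = \sum_(a <- P) c a * ip v a.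
Proof. by rewrite linear_sumr; apply: eq_bigr => a _; rewrite linearZr_LR. Qed.

Definition dominant v := forall a, a \in P -> 0 <= ip v a.

Lemma dominant_nonneg v b : dominant v -> nonneg_span P b -> 0 <= ip v b.
Proof.
move=> vD [c c0 ->]; rewrite ip_span big_seq.
by apply: sumr_ge0 => a aP; rewrite mulr_ge0 ?c0 ?vD.
Qed.

(** The inner product with [rho] is the height of a root: the sum of its coordinates
    over the simple roots.  Its sign tells positive roots from negative ones. *)
Definition rho := dualv (fun _ => 1).

Lemma rhoE a : a \in P -> ip rho a = 1.
Proof. exact: dualvE. Qed.

Lemma rho_dominant : dominant rho.
Proof. by move=> a aP; rewrite rhoE. Qed.

Lemma nonneg_rho_gt0 b : nonneg_span P b -> b != 0 -> 0 < ip rho b.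
Proof.
move=> bP; rewrite lt_def (dominant_nonneg rho_dominant bP) andbT.
apply: contraNneq; case: bP => c c0 ->; rewrite ip_span big_seq => /eqP.
rewrite psumr_eq0 => [/allP h|a aP]; last by rewrite rhoE // mulr1 c0.
rewrite big1_seq // => a /= aP; have := h a aP.
by rewrite aP /= rhoE // mulr1 => /eqP ->; rewrite scale0r.
Qed.

Lemma root_rho b : b \in roots Phi ->
  nonneg_span P b /\ 0 < ip rho b \/ nonneg_span P (- b) /\ ip rho b < 0.
Proof.
move=> bPhi; have b0 := root_neq0 bPhi; case: (root_dichotomy bPhi) => h.
  by left; split=> //; apply: nonneg_rho_gt0.
right; split=> //; rewrite -oppr_gt0 -linearNr.
by apply: nonneg_rho_gt0; rewrite ?oppr_eq0.
Qed.

Lemma root_pos b : b \in roots Phi -> 0 < ip rho b -> nonneg_span P b.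
Proof. by case/root_rho => -[] // _ h /lt_trans-/(_ _ h); rewrite ltxx. Qed.

Lemma root_neg b : b \in roots Phi -> ip rho b < 0 -> nonneg_span P (- b).
Proof. by case/root_rho => -[] // _ h /lt_trans-/(_ _ h); rewrite ltxx. Qed.

(** The reflection in [a] only changes the [a]-coordinate of [b].  The other coordinates
    are nonnegative in [b] and nonpositive in its image, hence zero, so [b] is a
    multiple of [a]. *)
Lemma simple_refl_pos a b : a \in P -> b \in roots Phi -> 0 < ip rho b ->
  ip rho (wrefl Phi a b) < 0 -> b = a.
Proof.
move=> aP bPhi bpos sbneg.
have aPhi := simple_root aP.
have sbN : nonneg_span P (- wrefl Phi a b) by apply: root_neg; rewrite ?weyl_root.
have bc : exists k, b = k *: a.
  have [c c0 bE] := root_pos bPhi bpos; exists (c a).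
  have cz d : d \in P -> d != a -> c d = 0.
    (* [om] reads off the [d]-coordinate. *)
    move=> dP da; pose om := dualv (fun e => (e == d)%:R).
    have omD : dominant om by move=> e eP; rewrite dualvE // ler0n.
    have omb : ip om b = c d.
      rewrite bE ip_span (big_fsetD1 d) //= dualvE // eqxx mulr1 big1_seq ?addr0 //.
      move=> e /= /fsetD1P[ed eP]; rewrite dualvE // (negPf ed) mulr0 //.
    apply/le_anti; rewrite c0 // andbT -omb -oppr_ge0.
    have := dominant_nonneg omD sbN; rewrite wreflE // /refl opprB linearBr /=.
    by rewrite linearZr_LR /= dualvE // eq_sym (negPf da) mulr0 sub0r.
  rewrite bE (big_fsetD1 a) //= big1_seq ?addr0 // => d /= /fsetD1P[da dP].
  by rewrite cz // scale0r.
case: bc => k bk; have [_ _ /(_ a k aPhi)] := rootsP Phi.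
rewrite -bk => /(_ bPhi)[] k1; first by rewrite bk k1 scale1r.
move: bpos; rewrite bk k1 scaleN1r linearNr /= rhoE // oppr_gt0.
by rewrite ltr10.
Qed.

Lemma mem_simple_refls x : reflect (exists2 a, a \in P & x = wrefl Phi a) (x \in S).
Proof.
rewrite inE; apply: (iffP (asboolP _)) => -[a aP xa]; exists a => //.
  by apply: weyl_eqP => v; rewrite wreflE ?simple_root // -reflfE xa.
by apply/lfunP => v; rewrite xa wreflE ?simple_root // reflfE.
Qed.

Lemma simple_refl_in a : a \in P -> wrefl Phi a \in S.
Proof. by move=> aP; apply/mem_simple_refls; exists a. Qed.

(** Take an element of the orbit of [b] under [<<S>>] that is positive and of least
    height.  It has a positive inner product with some simple root [a], because its own
    squared length is positive; reflecting in [a] lowers the height, so the result is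
    negative and the root is [a] by [simple_refl_pos]. *)
Lemma pos_root_conj b : b \in roots Phi -> 0 < ip rho b ->
  exists2 x, x \in <<S>>%g & x b \in P.
Proof.
move=> bPhi bpos.
pose good x := (x \in <<S>>%g) && (0 < ip rho (x b)).
have good1 : good 1%g by rewrite /good group1 weyl1.
case: (Order.TotalTheory.arg_minP (fun x => ip rho (x b)) good1) => x /andP[xS xpos] xmin.
exists x => //; have xPhi : x b \in roots Phi by rewrite weyl_root.
have [a aP xa] : exists2 a, a \in P & 0 < ip (x b) a.
  have [c c0 xE] := root_pos xPhi xpos; apply: contrapT => h.
  have : 0 < ip (x b) (x b) by apply: ip_gt0; apply: root_neq0 xPhi.
  rewrite {2}xE ip_span big_seq ltNge sumr_le0 // => a aP.
  rewrite mulr_ge0_le0 ?c0 // leNgt; apply/negP => xa; apply: h; by exists a.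
have aPhi := simple_root aP; have a0 := ip_gt0 ip (simple_neq0 aP).
have lt_sx : ip rho (wrefl Phi a (x b)) < ip rho (x b).
  rewrite wreflE // /refl linearBr /= linearZr_LR /= (rhoE aP) mulr1.
  by rewrite ltrBlDr ltrDl divr_gt0 // mulr_gt0.
have sPhi : wrefl Phi a (x b) \in roots Phi by rewrite weyl_root.
case: (root_rho sPhi) => [[_ spos]|[_ sneg]].
  have := xmin (wrefl Phi a * x)%g; rewrite /good weylM spos andbT.
  by rewrite groupM ?(mem_gen (simple_refl_in aP)) // => /(_ isT); rewrite leNgt lt_sx.
by rewrite (simple_refl_pos aP xPhi xpos sneg).
Qed.

Lemma wrefl_in_gen b : b \in roots Phi -> wrefl Phi b \in <<S>>%g.
Proof.
have pos c : c \in roots Phi -> 0 < ip rho c -> wrefl Phi c \in <<S>>%g.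
  move=> cPhi /(pos_root_conj cPhi)[x xS /simple_refl_in/mem_gen].
  by rewrite wrefl_conj // groupMr ?groupV // groupMl.
move=> bPhi; case: (root_rho bPhi) => -[_ h]; first exact: pos.
by rewrite -wreflN pos ?rootN // linearNr oppr_gt0.
Qed.

(** The reflection in a root is conjugate, by an element of [<<S>>], to a simple one. *)
Lemma simple_refls_gen : <<S>>%g = [set: weyl Phi]%g.
Proof.
apply/setP => w; rewrite in_setT.
suff gen (f : 'End(V)) : in_weyl Phi f -> exists2 x, x \in <<S>>%g & x = f :> 'End(V).
  by have [x xS /val_inj <-] := gen _ (weylP w).
elim=> {f} [a aPhi||f g _ [x xS <-] _ [y yS <-]|f _ [x xS <-]].
- exists (wrefl Phi a); first exact: wrefl_in_gen.
  by apply/lfunP => v; rewrite wreflE // reflfE.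
- by exists 1%g; rewrite ?group1.
- by exists (x * y)%g; rewrite ?groupM.
- by exists x^-1%g; rewrite ?groupV.
Qed.

(** * The deletion property and stabilizers of dominant vectors *)

Definition word t : weyl Phi := (\prod_(a <- t) wrefl Phi a)%g.

Lemma word_nil : word [::] = 1%g. Proof. exact: big_nil. Qed.
Lemma word_cons a t : word (a :: t) = (wrefl Phi a * word t)%g.
Proof. exact: big_cons. Qed.
Lemma word_rcons t a : word (rcons t a) = (word t * wrefl Phi a)%g.
Proof. by rewrite /word -cats1 big_cat big_seq1. Qed.

Lemma word_exists x : exists2 t, {subset t <= P} & x = word t.
Proof.
have : x \in <<S>>%g by rewrite simple_refls_gen inE.
case/gen_prodgP => n [c cS ->]; rewrite /word.
elim: n c cS => [|n IHn] c cS; first by exists [::]; rewrite ?big_ord0 ?big_nil.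
have [t tP tE] := IHn (fun i => c (lift ord0 i)) (fun i => cS _).
have [a aP aE] := mem_simple_refls _ (cS ord0).
exists (a :: t); last by rewrite big_ord_recl big_cons tE aE.
by move=> b /predU1P[->|/tP].
Qed.

(** Read from the right, the partial products of [t] applied to [a] pass from a
    positive root to a negative one; the letter at which this happens is that root
    by [simple_refl_pos], and it can be deleted against the reflection in [a]. *)
Lemma deletion t a : {subset t <= P} -> a \in P -> ip rho (word t a) < 0 ->
  exists t', [/\ {subset t' <= P}, size t = (size t').+1
               & (word t * wrefl Phi a)%g = word t'].
Proof.
move=> tP aP; elim: t tP => [|b t IHt] tP.
  by rewrite word_nil weyl1 rhoE // ltr10.
have bP : b \in P by rewrite tP ?mem_head.
have {}tP : {subset t <= P} by move=> c ct; rewrite tP // in_cons ct orbT.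
have taPhi : word t a \in roots Phi by rewrite weyl_root simple_root.
rewrite word_cons weylM => bta_neg.
case: (root_rho taPhi) => -[_ ta]; last first.
  have [t' [t'P st tE]] := IHt tP ta; exists (b :: t'); split.
  - by move=> c /predU1P[->|/t'P].
  - by rewrite /= st.
  - by rewrite word_cons -mulgA tE.
have bE := simple_refl_pos bP taPhi ta bta_neg.
exists t; split=> //; rewrite -bE wrefl_conj ?simple_root // !mulgKV.
by rewrite -mulgA wreflV ?simple_root // mulg1.
Qed.

(** The subset I of S for which [v], when dominant, lies in the face C_I. *)
Definition fixers v : {set weyl Phi} := [set s in S | s v == v].

Lemma simple_fixers a v : a \in P -> (wrefl Phi a \in fixers v) = (ip v a == 0).
Proof.
move=> aP; rewrite inE simple_refl_in // wreflE ?simple_root //.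
by rewrite refl_fixE ?simple_neq0.
Qed.

Lemma gen_fixers_fix v x : x \in <<fixers v>>%g -> x v = v.
Proof.
suff /subsetP h : (<<fixers v>> \subset stab Phi v)%g by move/h; rewrite inE => /eqP.
by rewrite gen_subG; apply/subsetP => s; rewrite !inE => /andP[].
Qed.

(** Induction on the length of the word.  Let [a] be its last letter and x the product of
    the others.  If x maps [a] to a negative root, [deletion] gives a shorter word for
    the same element.  If x maps [a] to a positive root, the inner product of [v] with
    [a] is both nonnegative and nonpositive, so the last letter fixes [v] and can be
    dropped. *)
Lemma word_dominant t v : {subset t <= P} -> dominant v -> dominant (word t v) ->
  word t v = v /\ word t \in <<fixers v>>%g.
Proof.
have [m] := ubnP (size t); elim: m t => // m IHm t; rewrite ltnS => tm tP vD tvD.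
case/lastP: t => [|t a] in tm tP tvD *.
  by rewrite word_nil weyl1 group1.
rewrite size_rcons in tm.
have aP : a \in P by rewrite tP // mem_rcons mem_head.
have {}tP : {subset t <= P} by move=> c ct; rewrite tP // mem_rcons in_cons ct orbT.
have taPhi : word t a \in roots Phi by rewrite weyl_root simple_root.
case: (root_rho taPhi) => -[taN ta]; last first.
  have [t' [t'P st tE]] := deletion tP aP ta.
  by move: tvD; rewrite word_rcons tE => tvD; apply: IHm => //; rewrite -ltnS -st ltnW.
have va : ip v a = 0.
  apply/le_anti; rewrite vD // andbT -(weyl_ip (word (rcons t a))).
  have := dominant_nonneg tvD taN; rewrite word_rcons !weylM wrefl_self ?simple_root //.
  by rewrite linearN linearNr oppr_le0.
have av : wrefl Phi a v = v by apply/eqP; rewrite wreflE ?simple_root // refl_fixE ?simple_neq0 ?va.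
move: tvD; rewrite word_rcons weylM av => tvD.
have [tv tF] := IHm t tm tP vD tvD; split=> //.
by rewrite groupM // mem_gen // simple_fixers // va.
Qed.

Lemma dominant_unique x v : dominant v -> dominant (x v) -> x v = v.
Proof. by have [t tP ->] := word_exists x => vD /(word_dominant tP vD)[]. Qed.

Lemma dominant_stab x v : dominant v -> (x v == v) = (x \in <<fixers v>>%g).
Proof.
move=> vD; apply/eqP/idP => [xv|/gen_fixers_fix //].
have [t tP xE] := word_exists x; rewrite xE in xv *.
by apply: (word_dominant tP vD _).2; rewrite xv.
Qed.

(** A vector of the orbit of [v] with maximal inner product with [rho] is dominant:
    a simple reflection would otherwise increase this inner product. *)
Lemma dominant_conj v : exists x, dominant (x v).
Proof.
case: (Order.TotalTheory.arg_maxP (fun x => ip rho (x v))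
         (isT : xpredT (1%g : weyl Phi))) => x _ xmax.
exists x => a aP; have := xmax (wrefl Phi a * x)%g isT.
rewrite weylM wreflE ?simple_root // /refl linearBr /= linearZr_LR /= (rhoE aP) mulr1.
rewrite gerBl pmulr_lge0 ?invr_gt0 ?ip_gt0 ?simple_neq0 //.
by rewrite pmulr_rge0.
Qed.

(** * Faces of the dominant chamber *)

(** A sample point of the face C_I of the dominant chamber. *)
Definition facept I := dualv (fun a => (wrefl Phi a \notin I)%:R).

Lemma faceptE I a : a \in P -> ip (facept I) a = (wrefl Phi a \notin I)%:R.
Proof. exact: dualvE. Qed.

Lemma facept_dominant I : dominant (facept I).
Proof. by move=> a aP; rewrite faceptE // ler0n. Qed.

Lemma fixers_facept I : I \subset S -> fixers (facept I) = I.
Proof.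
move=> /subsetP IS; apply/setP => s; apply/idP/idP => [sF|sI].
  have /mem_simple_refls[a aP sE] : s \in S by move: sF; rewrite inE => /andP[].
  by move: sF; rewrite sE simple_fixers // faceptE // pnatr_eq0 eqb0 negbK.
have /mem_simple_refls[a aP sE] := IS _ sI.
by rewrite sE simple_fixers // faceptE // -sE sI.
Qed.

Lemma fixers_sub v : fixers v \subset S.
Proof. by apply/subsetP => s; rewrite inE => /andP[]. Qed.

Lemma facept_stab I x : I \subset S -> (x (facept I) == facept I) = (x \in <<I>>%g).
Proof. by move=> IS; rewrite dominant_stab ?fixers_facept //; apply: facept_dominant. Qed.

Lemma wrefl_simple_inj : {in P &, injective (wrefl Phi)}.
Proof.
move=> a b aP bP ab; apply/eqP/negP => /negP nab.
pose om := dualv (fun c => (c == a)%:R).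
have := congr1 (ip om) (wrefl_self (simple_root aP)).
rewrite ab wreflE ?simple_root // /refl linearBr linearNr /= linearZr_LR /= !dualvE //.
rewrite eqxx eq_sym (negPf nab) mulr0 subr0 => /eqP.
by rewrite -subr_eq0 opprK -natrD pnatr_eq0.
Qed.

(** The linear span of the face C_I. *)
Definition face_space I : {vspace V} :=
  orthov ip <<[seq a <- P | wrefl Phi a \in I]>>.

Lemma mem_face_space I v :
  reflect (forall a, a \in P -> wrefl Phi a \in I -> ip v a = 0) (v \in face_space I).
Proof.
apply: (iffP idP) => [/mem_orthovP h a aP aI|h].
  by apply: h; rewrite memv_span // mem_filter aI.
apply/mem_orthovP => u us.
rewrite (coord_span (X := in_tuple [seq a <- P | wrefl Phi a \in I]) us).
rewrite linear_sumr big1 //= => i _.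
rewrite linearZr_LR /=.
have : [seq a <- P | wrefl Phi a \in I]`_i \in [seq a <- P | wrefl Phi a \in I] by rewrite mem_nth.
by rewrite mem_filter => /andP[? ?]; rewrite [ip _ _]h ?mulr0.
Qed.

Lemma dim_face_space I : I \subset S -> (\dim (face_space I) + #|I| = \dim {:V})%N.
Proof.
move=> /subsetP IS; set s := [seq a <- P | wrefl Phi a \in I].
have -> : #|I| = size s.
  rewrite -(size_map (wrefl Phi)) -(card_uniqP _).
    apply: eq_card => x; apply/idP/mapP => [xI|[a]]; last first.
      by rewrite mem_filter => /andP[aI _] ->.
    have /mem_simple_refls[a aP xE] := IS x xI.
    by exists a; rewrite // mem_filter -xE xI.
  rewrite map_inj_in_uniq ?filter_uniq ?fset_uniq // => a b.
  by rewrite !mem_filter => /andP[_ aP] /andP[_ bP]; apply: wrefl_simple_inj.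
have fs : free s by case: hP => _ fP _ _; apply: filter_free.
by have [_ <-] := gram_image ip fs.
Qed.

(** In a sum of nonnegative terms equal to zero every term is zero, so vanishing on the
    simple roots controls vanishing on all roots. *)
Lemma root_zero d u b : dominant d -> b \in roots Phi ->
  (forall a, a \in P -> ip d a = 0 -> ip u a = 0) -> ip d b = 0 -> ip u b = 0.
Proof.
move=> dD bPhi du; have pos c : nonneg_span P c -> ip d c = 0 -> ip u c = 0.
  case=> k k0 ->; rewrite !ip_span big_seq => /eqP.
  rewrite psumr_eq0 => [/allP h|a aP]; last by rewrite mulr_ge0 ?k0 ?dD.
  rewrite big1_seq // => a /= aP; have := h a aP; rewrite aP /= mulf_eq0.
  by case/orP => /eqP ka; rewrite ?ka ?mul0r // du ?mulr0.
case: (root_dichotomy bPhi) => /pos // h db; apply: oppr_inj.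
by rewrite -ipNr oppr0 h // ipNr db oppr0.
Qed.

(** A root is a combination of simple roots with coefficients of one sign, so the sign of
    a dominant vector on it depends only on the simple roots orthogonal to this vector. *)
Lemma face_signs d e b : dominant d -> dominant e -> b \in roots Phi ->
  (forall a, a \in P -> (ip d a == 0) = (ip e a == 0)) ->
  Num.sg (ip d b) = Num.sg (ip e b).
Proof.
move=> dD eD bPhi de.
have zero c : c \in roots Phi -> ip d c = 0 <-> ip e c = 0.
  by move=> cPhi; split; apply: root_zero => // a aP /eqP; [rewrite de|rewrite -de] => // /eqP.
case: (root_dichotomy bPhi) => bP.
  by apply: sgr_ge0_eq; [exact: dominant_nonneg | exact: dominant_nonneg | exact: zero].
apply: oppr_inj; rewrite -!sgrN -!ipNr.
apply: sgr_ge0_eq; [exact: dominant_nonneg | exact: dominant_nonneg | ].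
by apply: zero; rewrite rootN.
Qed.

(** If the two vectors have the same signs on all roots, then [x^-1 * y] maps [d] to a
    vector with the signs of [facept I] on the simple roots.  This vector is dominant, so
    it is [d] itself by [dominant_unique]; hence [d] lies in C_I and [x^-1 * y] stabilizes
    it.  So sign classes are faces x C_I, and each comes from one coset of W_I. *)
Lemma same_signs_facept I x y d : I \subset S -> dominant d ->
  same_signs ip (roots Phi) (x (facept I)) (y d)
    = (I == fixers d) && (x \in y *: <<fixers d>>)%g.
Proof.
move=> IS dD; rewrite mem_lcoset; apply/allP/andP => [h|[/eqP IE xy] b bPhi].
  pose z := (x^-1 * y)%g.
  have {}h b : b \in roots Phi -> Num.sg (ip (facept I) b) = Num.sg (ip (z d) b).
    move=> bPhi; have := h (x b); rewrite weyl_root => /(_ bPhi)/eqP.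
    by rewrite weyl_ip -[ip (y d) _](weyl_ip x^-1%g) weylVK -weylM.
  have zD : dominant (z d).
    move=> a aP; rewrite -sgr_ge0 -h ?simple_root // sgr_ge0; exact: facept_dominant.
  have zd := dominant_unique dD zD; rewrite zd in h.
  have /eqP := zd; rewrite dominant_stab // -groupV invMg invgK => ->; split=> //.
  rewrite -(fixers_facept IS); apply/eqP/setP => s.
  apply/idP/idP => sF; have /mem_simple_refls[a aP sE] := subsetP (fixers_sub _) s sF;
    move: sF; rewrite sE !simple_fixers // -sgr_eq0.
    by rewrite h ?simple_root // sgr_eq0.
  by rewrite -h ?simple_root // sgr_eq0.
have xE : x (facept I) = y (facept I).
  rewrite -[in LHS](mulKVg y x) weylM; congr (fun_of_lfun (weyl_val y) _).
  by apply/eqP; rewrite facept_stab // IE.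
rewrite xE !(weyl_adj y); apply/eqP/face_signs; rewrite ?weyl_root //.
  exact: facept_dominant.
by move=> a aP; rewrite faceptE // IE simple_fixers // pnatr_eq0 eqb0 negbK.
Qed.

(** The conjugate of [w] by [y] stabilizes [d], so it is a product of reflections in [I];
    thus [w] fixes the whole span of the face y C_I once it fixes one of its points. *)
Lemma fix_face w y d I : w (y d) = y d -> dominant d -> I = fixers d ->
  forall u, (forall s, s \in I -> s u = u) -> w (y u) = y u.
Proof.
move=> wyd dD IE u Iu.
have wy : (y^-1 * (w * y))%g \in <<I>>%g.
  by rewrite IE -dominant_stab // !weylM wyd weylVK.
have /subsetP h : (<<I>> \subset stab Phi u)%g.
  by rewrite gen_subG; apply/subsetP => s sI; rewrite inE Iu.
by have := h _ wy; rewrite inE !weylM => /eqP h'; rewrite -{2}h' weylKV.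
Qed.

(** With I the set [fixers d], the span of the sign class of [y d] is the image under [y]
    of the span of C_I, and it lies in V^w because [w] fixes [y d]. *)
Lemma face_space_image w y d : w (y d) = y d -> dominant d ->
  (fixv w :&: zero_space ip (roots Phi) (y d) = (y : 'End(V)) @: face_space (fixers d))%VS.
Proof.
move=> wyd dD; apply/vspaceP => u; rewrite memv_cap mem_fixv; apply/andP/memv_imgP.
  case=> _ uZ; exists (y^-1%g u); last by rewrite weylKV.
  apply/mem_face_space => a aP; rewrite simple_fixers // => /eqP da.
  rewrite -(weyl_ip y) weylKV; move: uZ; rewrite mem_zero_space => /allP/(_ (y a)).
  rewrite weyl_root simple_root // weyl_ip da eqxx => /(_ isT)/eqP; exact.
case=> t /mem_face_space tJ ->; split.
  apply/eqP/(fix_face wyd dD (erefl _)) => s sJ.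
  have /mem_simple_refls[a aP sE] := subsetP (fixers_sub _) s sJ.
  by rewrite sE wreflE ?simple_root //; apply/eqP; rewrite refl_fixE ?simple_neq0 // tJ -?sE.
rewrite mem_zero_space; apply/allP => b bPhi; apply/implyP.
rewrite !(weyl_adj y) => /eqP db; apply/eqP; apply: (root_zero dD) db.
  by rewrite weyl_root.
by move=> a aP /eqP da; apply: tJ; rewrite // simple_fixers.
Qed.

Lemma dim_weyl_image y (U : {vspace V}) : \dim ((y : 'End(V)) @: U) = \dim U.
Proof.
by apply: limg_dim_eq; rewrite (eqP (weyl_lker0 (weylP y))) capv0.
Qed.

(** * Solomon's formula *)

(** The pair (x, I) names the face x C_I. *)
Definition cell_point (i : weyl Phi * {set weyl Phi}) : V := i.1 (facept i.2).

(** Every face x C_I is named by |W_I| pairs, whence the denominator.  The numerator is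
    (-1)^(dim C_I), the codimension of C_I being |I|. *)
Definition face_weight (i : weyl Phi * {set weyl Phi}) : R :=
  if i.2 \subset S then (-1) ^+ (\dim {:V} + #|i.2|) / #|<<i.2>>%g|%:R else 0.

(** The sign class of [v] is one face y C_J, named by |W_J| pairs of equal weight.  This
    is the hypothesis of Euler's relation for the fixed space of [w]. *)
Lemma face_class_sum w v : w v = v ->
  \sum_(i : weyl Phi * {set weyl Phi} | (cell_point i \in fixv w) &&
             same_signs ip (roots Phi) (cell_point i) v) face_weight i
    = (-1) ^+ \dim (fixv w :&: zero_space ip (roots Phi) v).
Proof.
have [x xvD] := dominant_conj v; have vE : v = x^-1%g (x v) by rewrite weylVK.
move: x^-1%g (x v) vE xvD => y d -> dD {x v}.
move=> wyd; set J := fixers d.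
have JS : J \subset S := fixers_sub d.
(* The pairs (x, J) with x in the coset of [y] all have the same weight, and there are
   |W_J| of them. *)
rewrite face_space_image // dim_weyl_image.
rewrite (bigID (fun i : weyl Phi * {set weyl Phi} => i.2 \subset S)) /= addrC.
rewrite big1 ?add0r => [|i /andP[_ /negPf iS]]; last by rewrite /face_weight iS.
rewrite (eq_bigl (fun i => i \in setX (y *: <<J>>)%g [set J])) => [|[x I] /=]; last first.
  rewrite in_setX inE; apply/andP/andP => [[/andP[_ h] IS]|[xy /eqP IJ]].
    by move: h; rewrite same_signs_facept // => /andP[-> ->].
  rewrite IJ JS same_signs_facept // eqxx /= xy andbT; split=> //.
  have xE : x (facept J) = y (facept J).
    rewrite -[in LHS](mulKVg y x) weylM; congr (fun_of_lfun (weyl_val y) _).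
    by apply/eqP; rewrite facept_stab // -mem_lcoset.
  rewrite mem_fixv /cell_point /= xE; apply/eqP/(fix_face wyd dD (erefl _)) => s sJ.
  by apply/eqP; rewrite facept_stab // mem_gen.
rewrite (eq_bigr (fun _ => (-1) ^+ (\dim {:V} + #|J|) / #|<<J>>%g|%:R)) => [|[x I]]; last first.
  by rewrite in_setX => /andP[_ /set1P /= ->]; rewrite /face_weight /= JS.
rewrite sumr_const cardsX card_lcoset cards1 muln1 -[LHS]mulr_natr mulfVK; last first.
  by rewrite pnatr_eq0 -lt0n cardG_gt0.
by rewrite -(dim_face_space JS) -addnA addnn -mul2n exprD exprM sqrrN expr1n expr1n mulr1.
Qed.

(** Exchanging the sums over x and I turns Euler's relation in V^w into the formula for
    induced characters: the condition that [w] fixes the point of x C_I reads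
    [w ^ x \in <<I>>]. *)
Lemma solomon_formula w : endo_det w =
  \sum_(I : {set weyl Phi} | I \subset S) (-1) ^+ #|I| * ind_triv R [set: weyl Phi]%G <<I>>%G w.
Proof.
have [Iw _ _] := weyl_axiom (weylP w).
have sum_fix := @euler_relation _ _ ip _ cell_point face_weight (roots Phi) (fixv w) [::].
rewrite (endo_det_isometry Iw) exprD -(sum_fix _ 0) ?mem0v //; last first.
  by move=> v; rewrite mem_fixv => /eqP wv _; rewrite -(face_class_sum wv).
rewrite mulr_sumr.
under eq_bigl do rewrite andbT.
rewrite big_mkcond -(pair_bigA _ (fun x I => if cell_point (x, I) \in fixv w
  then (-1) ^+ \dim {:V} * face_weight (x, I) else 0)) exchange_big /=.
rewrite [RHS]big_mkcond; apply: eq_bigr => I _; rewrite /face_weight /=.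
case: ifP => IS; last by rewrite big1 // => x _; rewrite mulr0 if_same.
rewrite ind_trivE ?subsetT // 2!mulr_sumr; apply: eq_big => [x|x _].
  by rewrite inE.
have -> : (w ^ x \in <<I>>)%g = (cell_point (x, I) \in fixv w).
  rewrite -facept_stab // conjgE !weylM mem_fixv /cell_point.
  by rewrite -(inj_eq (can_inj (weylVK x))) weylKV.
case: ifP => _; rewrite ?mulr0 // mulr1 mulrA -exprD addnA addnn exprD.
by rewrite -mul2n exprM sqrrN expr1n expr1n mul1r.
Qed.
End SimpleSystem.

(** * Alternating sums over chains *)

Section Chains.
Variables (R : comRingType) (T : finType).
Implicit Types (S J K L : {set T}) (f : {set T} -> R).

(** If [x] lies in [S] but not in [L], adding or removing [x] is a sign-reversing
    involution of the interval between [L] and [S]. *)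
Lemma interval_sign_sum L S : L \subset S ->
  \sum_(K : {set T} | (L \subset K) && (K \subset S)) (-1) ^+ #|K|
    = (if L == S then (-1) ^+ #|S| else 0) :> R.
Proof.
move=> LS; have [<-|LnS] := eqVneq L S.
  by rewrite (big_pred1 L) // => K; rewrite /= eq_sym eqEsubset.
have /subsetPn[x xS xL] : ~~ (S \subset L).
  by apply: contra LnS => SL; rewrite eqEsubset LS.
rewrite (bigID (fun K : {set T} => x \in K)) /=.
rewrite (reindex_onto (fun K => x |: K) (fun K => K :\ x)) /=; last first.
  by move=> K /andP[_ xK]; rewrite setD1K.
rewrite (eq_bigl (fun K => (L \subset K) && (K \subset S) && (x \notin K))) => [|K]; last first.
  have [xK|xK] := boolP (x \in K).
    rewrite andbF; apply/negP => /andP[_ /eqP KE].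
    by move: xK; rewrite -KE setD11.
  rewrite setU1K // eqxx setU11 !andbT subUset sub1set xS; congr (_ && _).
  apply/idP/idP => LK; last by rewrite (subset_trans LK) ?subsetU1.
  apply/subsetP => y yL; have := subsetP LK y yL; rewrite in_setU1.
  by case: eqP => // yx; rewrite -yx yL in xL.
rewrite (eq_bigr (fun K : {set T} => - (-1) ^+ #|K|)) => [|K /andP[_ xK]]; last first.
  by rewrite cardsU1 xK exprS mulN1r.
by rewrite sumrN addNr.
Qed.

Definition chain_sum S n f : R :=
  \sum_(I in chains S n) (-1) ^+ (\sum_(k < n) #|I (lift ord0 k)|)%N * f (I ord_max).

Definition cons_chain S n (I : {ffun 'I_n.+1 -> {set T}}) : {ffun 'I_n.+2 -> {set T}} :=
  [ffun i => if unlift ord0 i is Some j then I j else S].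

Lemma cons_chain0 S n (I : {ffun 'I_n.+1 -> {set T}}) : cons_chain S I ord0 = S.
Proof. by rewrite ffunE unlift_none. Qed.

Lemma cons_chainS S n (I : {ffun 'I_n.+1 -> {set T}}) j : cons_chain S I (lift ord0 j) = I j.
Proof. by rewrite ffunE liftK. Qed.

Lemma cons_chain_in S n (I : {ffun 'I_n.+1 -> {set T}}) :
  (cons_chain S I \in chains S n.+1) = (I ord0 \subset S) && (I \in chains (I ord0) n).
Proof.
rewrite !inE cons_chain0 !eqxx /=.
have w0 : widen_ord (leqnSn n.+1) ord0 = ord0 by apply: val_inj.
have wS (j : 'I_n) : widen_ord (leqnSn n.+1) (lift ord0 j) = lift ord0 (widen_ord (leqnSn n) j).
  exact: val_inj.
apply/forallP/andP => [h|[I0 /forallP h] k].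
  split; first by have := h ord0; rewrite cons_chainS w0 cons_chain0.
  by apply/forallP => j; have := h (lift ord0 j); rewrite cons_chainS wS cons_chainS.
rewrite cons_chainS; case: (unliftP ord0 k) => [j|] ->.
  by rewrite wS cons_chainS.
by rewrite w0 cons_chain0.
Qed.

(** Chains starting at [S] correspond to a first step [K] together with a shorter chain
    starting at [K]. *)
Lemma chain_sumS S n f :
  chain_sum S n.+1 f = \sum_(K : {set T} | K \subset S) (-1) ^+ #|K| * chain_sum K n f.
Proof.
rewrite /chain_sum (reindex_onto (@cons_chain S n) (fun I => [ffun j => I (lift ord0 j)])) /=.
  under eq_bigl => I.
    rewrite cons_chain_in (_ : [ffun j => cons_chain S I (lift ord0 j)] == I) ?andbT; last first.
      by apply/eqP/ffunP => j; rewrite ffunE cons_chainS.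
    over.
  rewrite (partition_big (fun I : {ffun 'I_n.+1 -> {set T}} => I ord0)
             (fun K => K \subset S)) /=; last first.
    by move=> I /andP[].
  apply: eq_bigr => K KS; rewrite mulr_sumr; apply: eq_big => [I|I /andP[_ /eqP IK]].
    by rewrite !inE eqxx /=; case: eqP => [->|_]; rewrite ?andbF // KS andbT.
  have -> : ord_max = lift ord0 ord_max :> 'I_n.+2 by apply: val_inj.
  rewrite cons_chainS; under eq_bigr do rewrite cons_chainS.
  by rewrite big_ord_recl IK exprD mulrA.
move=> I; rewrite inE => /andP[/eqP I0 _]; apply/ffunP => i; rewrite ffunE.
by case: unliftP => [j ->|->]; rewrite ?ffunE.
Qed.

Lemma chain_sum0 S f : chain_sum S 0 f = f S.
Proof.
rewrite /chain_sum (big_pred1 [ffun _ => S]) => [|I].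
  by rewrite big_ord0 expr0 mul1r ffunE.
rewrite inE; apply/andP/eqP => [[/eqP I0 _]|->].
  by apply/ffunP => i; rewrite ffunE (ord1 i).
by rewrite ffunE; split=> //; apply/forallP => -[].
Qed.

(** Exchanging the sums over the first two steps K and L leaves, for each L, the sum of
    (-1)^|K| over the interval from L to [S], which vanishes unless L is [S]. *)
Lemma chain_sum_period S n f :
  chain_sum S n.+2 f = chain_sum S n f.
Proof.
rewrite chain_sumS.
under eq_bigr do rewrite chain_sumS mulr_sumr.
rewrite (exchange_big_dep (fun L : {set T} => L \subset S)) /=; last first.
  by move=> K L KS /subset_trans; apply.
rewrite (bigD1 S) //= [X in _ + X]big1 ?addr0 => [|L /andP[LS LnS]].
  rewrite (big_pred1 S) => [|K]; last by rewrite /= eqEsubset andbC.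
  by rewrite mulrA -exprD addnn -mul2n exprM sqrrN expr1n expr1n mul1r.
rewrite -mulr_suml (eq_bigl (fun K : {set T} => (L \subset K) && (K \subset S))).
  by rewrite interval_sign_sum // (negPf LnS) mul0r.
by move=> K; rewrite andbC.
Qed.
End Chains.

(** * The determinant formula *)

Theorem mainTheorem3 (R : realType) (V : vectType R) (ip : {dot V for idfun})
    (Phi : rootSystem ip) (P : {fset V}) (n : nat)
    (hP : is_simple_system Phi P) (hspan : <<P>>%VS = {:V}%VS)
    (hn : (1 <= n)%N) (w : weyl Phi) :
  endo_det (diag_endo n w) = endo_det w ^+ n /\
  endo_det w ^+ n =
    \sum_(I in chains (simple_refls Phi P) n)
       (-1) ^+ (\sum_(k < n) #|I (lift ord0 k)|)%N
         * ind_triv R [set: weyl Phi]%G <<I ord_max>>%G w.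
Proof.
split; first exact: endo_det_diag_weyl.
rewrite -[RHS]/(chain_sum (simple_refls Phi P) n
  (fun J => ind_triv R [set: weyl Phi]%G <<J>>%G w)).
have [Iw _ _] := weyl_axiom (weylP w).
have det2 : endo_det w ^+ 2 = 1.
  by rewrite (endo_det_isometry Iw) -exprM mulnC exprM sqrrN !expr1n.
have sum0 : chain_sum (simple_refls Phi P) 0
    (fun J => ind_triv R [set: weyl Phi]%G <<J>>%G w) = 1.
  rewrite chain_sum0 ind_trivE ?subsetT // (eq_bigr (fun _ => 1)) => [|x _]; last first.
    by rewrite /= (simple_refls_gen hP) inE.
  rewrite sumr_const /= (simple_refls_gen hP) mulVf //.
  by rewrite pnatr_eq0 -lt0n (cardG_gt0 [set: weyl Phi]%G).
(* Steps of two: both sides are unchanged when [n] grows by two. *)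
elim/ltn_ind: {hn} n => -[|[|n]] IHn; first by rewrite sum0.
  rewrite chain_sumS expr1 (solomon_formula hP); apply: eq_bigr => I _.
  by rewrite chain_sum0.
by rewrite chain_sum_period -IHn // -addn2 exprD det2 mulr1.
Qed.
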